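(* $\mathfrak{L}(\mathbb{E}^1)=\mathfrak{L}(\mathbb{L}_2^1\vee\mathbb{Q}^1)\cup[\mathbb{L}_2^1\vee\mathbb{Q}^1,\mathbb{E}^1]$.
   Context: Monoids are algebras in the signature $\{\cdot,1\}$; a monoid variety is a class of monoids defined by a set of identities. For a semigroup $S$ without identity, $S^1=S\cup\{1\}$ is the monoid obtained by adjoining an identity. $\mathbb{E}^1,\mathbb{L}_2^1,\mathbb{Q}^1$ denote the monoid varieties generated by $E^1,L_2^1,Q^1$ respectively, where (with $0$ denoting a zero element) $E=\langle a,b,c\mid a^2=ab=0,\ ba=ca=a,\ b^2=bc=b,\ c^2=cb=c\rangle$, $L_2=\langle a,b\mid a^2=ab=a,\ b^2=ba=b\rangle$, $Q=\langle a,b,c\mid a^2=a,\ ab=b,\ ca=c,\ ac=ba=cb=0\rangle$. $\mathfrak{L}(\mathbb{V})$ is the lattice of all subvarieties of $\mathbb{V}$; $[\mathbb{U},\mathbb{V}]$ is the interval of all subvarieties of $\mathbb{V}$ containing $\mathbb{U}$; $\vee$ is the join of monoid varieties. *)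

(* Defs.v *)
From HB Require Import structures.
From mathcomp Require Import all_boot.
From mathcomp Require Import boolp.

Set Implicit Arguments.
Unset Strict Implicit.
Unset Printing Implicit Defensive.

Local Open Scope group_scope.
Local Open Scope quotient_scope.

(* The free semigroup on A; (x, s) stands for the nonempty word x :: s. *)
Definition word (A : Type) : Type := (A * seq A)%type.

HB.instance Definition _ (A : choiceType) := Choice.on (word A).

Definition gen (A : Type) (x : A) : word A := (x, [::]).

Definition word_mul (A : Type) (u v : word A) : word A :=
  (u.1, u.2 ++ v.1 :: v.2).

Lemma word_mulA (A : Type) : associative (@word_mul A).
Proof. by move=> u v w; rewrite /word_mul /= -catA. Qed.

HB.instance Definition _ (A : choiceType) :=
  isSemigroup.Build (word A) (@word_mulA A).

Section Presentation.
Variables (A : choiceType) (R : word A -> word A -> Prop).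

Inductive cong_gen : word A -> word A -> Prop :=
| cong_rel u v : R u v -> cong_gen u v
| cong_refl u : cong_gen u u
| cong_sym u v : cong_gen u v -> cong_gen v u
| cong_trans u v w : cong_gen u v -> cong_gen v w -> cong_gen u w
| cong_mul u u' v v' :
    cong_gen u u' -> cong_gen v v' -> cong_gen (u * v) (u' * v').

Definition cong_genb : rel (word A) := fun u v => `[< cong_gen u v >].

Lemma cong_genb_refl : reflexive cong_genb.
Proof. by move=> u; apply/asboolP/cong_refl. Qed.

Lemma cong_genb_sym : symmetric cong_genb.
Proof. by move=> u v; apply/asboolP/asboolP => /cong_sym. Qed.

Lemma cong_genb_trans : transitive cong_genb.
Proof.
by move=> v u w /asboolP uv /asboolP vw; apply/asboolP/(cong_trans uv vw).
Qed.

Canonical cong_gen_equiv :=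
  EquivRel cong_genb cong_genb_refl cong_genb_sym cong_genb_trans.

(* The semigroup presented by < A | R >. *)
Definition presented : Type := {eq_quot cong_gen_equiv}.

HB.instance Definition _ := Choice.on presented.
HB.instance Definition _ := Quotient.on presented.
HB.instance Definition _ := EqQuotient.on presented.

Definition presented_mul (x y : presented) : presented :=
  \pi_presented (repr x * repr y).

Lemma presented_mulE u v :
  presented_mul (\pi_presented u) (\pi_presented v) = \pi_presented (u * v).
Proof.
have pirepr w : cong_gen (repr (\pi_presented w)) w.
  by apply/asboolP; rewrite -[`[< _ >]]/(cong_gen_equiv _ _) -eqmodE reprK.
by apply/eqmodP/asboolP; apply: cong_mul; apply: pirepr.
Qed.

Lemma presented_mulA : associative presented_mul.
Proof.
move=> x y z.
have piK (w : presented) : \pi_presented (repr w) = w by apply: reprK.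
by rewrite -(piK x) -(piK y) -(piK z) !presented_mulE mulgA.
Qed.

HB.instance Definition _ := isSemigroup.Build presented presented_mulA.

End Presentation.

(* In a presentation mentioning 0, the letter None : option A denotes 0 and
   0 w = w 0 = 0 is imposed for all words w. *)
Definition with_zero (A : choiceType)
    (R : word (option A) -> word (option A) -> Prop)
    (u v : word (option A)) : Prop :=
  let z := gen None in
  R u v \/ (exists w, (u = z * w \/ u = w * z) /\ v = z).

Definition rels (A : choiceType) (s : seq (word A * word A)) (u v : word A) :
  Prop := (u, v) \in s.

(* S^1: None is the adjoined identity. It is adjoined unconditionally, so
   this is the usual S^1 only when S has no identity, as for E, L_2 and Q. *)
Section AdjoinOne.
Variable S : semigroupType.

Definition adjoin1 : Type := option S.

HB.instance Definition _ := Choice.on adjoin1.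

Definition adjoin1_mul (x y : adjoin1) : adjoin1 :=
  match x, y with
  | None, _ => y
  | _, None => x
  | Some s, Some t => Some (s * t)
  end.

Lemma adjoin1_mulA : associative adjoin1_mul.
Proof. by move=> [x|] [y|] [z|] //=; rewrite mulgA. Qed.

Lemma adjoin1_mul1x : left_id (None : adjoin1) adjoin1_mul.
Proof. by case. Qed.

Lemma adjoin1_mulx1 : right_id (None : adjoin1) adjoin1_mul.
Proof. by case. Qed.

HB.instance Definition _ :=
  isMonoid.Build adjoin1 adjoin1_mulA adjoin1_mul1x adjoin1_mulx1.

End AdjoinOne.

Definition let0 : 'I_3 := @Ordinal 3 0 isT.
Definition let1 : 'I_3 := @Ordinal 3 1 isT.
Definition let2 : 'I_3 := @Ordinal 3 2 isT.

Definition E_rels : seq (word (option 'I_3) * word (option 'I_3)) :=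
  let a := gen (Some let0) in
  let b := gen (Some let1) in
  let c := gen (Some let2) in
  let z := gen None in
  [:: (a * a, z); (a * b, z); (b * a, a); (c * a, a);
      (b * b, b); (b * c, b); (c * c, c); (c * b, c)].

Definition Q_rels : seq (word (option 'I_3) * word (option 'I_3)) :=
  let a := gen (Some let0) in
  let b := gen (Some let1) in
  let c := gen (Some let2) in
  let z := gen None in
  [:: (a * a, a); (a * b, b); (c * a, c);
      (a * c, z); (b * a, z); (c * b, z)].

Definition L2_rels : seq (word bool * word bool) :=
  let a := gen false in
  let b := gen true in
  [:: (a * a, a); (a * b, a); (b * b, b); (b * a, b)].

Definition sgE : semigroupType := presented (with_zero (rels E_rels)).
Definition sgQ : semigroupType := presented (with_zero (rels Q_rels)).
Definition sgL2 : semigroupType := presented (rels L2_rels).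

(* Identities u = v, with u and v words (possibly empty) over the countable set
   of variables nat. *)
Definition identity : Type := (seq nat * seq nat)%type.

Definition satisfies (M : monoidType) (e : identity) : Prop :=
  forall f : nat -> M, \prod_(i <- e.1) f i = \prod_(i <- e.2) f i.

(* Classes of monoids. The type set of mathcomp.classical cannot be used here
   (set monoidType is a universe inconsistency), so inclusion, union and
   equality of classes, and of families of classes, are written pointwise.
   The choice structure bundled in monoidType does not restrict the carriers,
   since mathcomp.classical equips every type with one. *)
Definition mclass := monoidType -> Prop.

Definition subclass (U V : mclass) : Prop := forall M, U M -> V M.

Definition is_variety (V : mclass) : Prop :=
  exists Sigma : identity -> Prop,
    forall M, V M <-> (forall e, Sigma e -> satisfies M e).

(* The least variety containing K. *)
Definition variety_gen (K : mclass) : mclass :=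
  fun M => forall V, is_variety V -> subclass K V -> V M.

Definition variety_of (M : monoidType) : mclass :=
  variety_gen (fun N => N = M).

Definition vjoin (U V : mclass) : mclass :=
  variety_gen (fun M => U M \/ V M).

(* Membership in the lattice L(V) of subvarieties of V. *)
Definition subvarieties (V W : mclass) : Prop := is_variety W /\ subclass W V.

(* Membership in the interval [U, V]. *)
Definition interval_varieties (U V W : mclass) : Prop :=
  subvarieties V W /\ subclass U W.

Definition varE1 : mclass := variety_of (adjoin1 sgE).
Definition varL21 : mclass := variety_of (adjoin1 sgL2).
Definition varQ1 : mclass := variety_of (adjoin1 sgQ).

(* Main.v *)
(* Split a word at its letters occurring exactly once. An identity u = v holds
   in Q^1 iff u and v have the same such letters in the same order and blocks
   with the same contents, in L_2^1 iff letters first occur in u and v in the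
   same order, and in E^1 only if both conditions are met. Conversely E^1
   satisfies xhx = xxhx = xhxx and xxyyxx = xxyy, so that in a monoid M of
   var(E^1) the idempotents form a left regular band and every letter occurring
   at least twice may be replaced by its square. If M satisfies an identity
   failing in L_2^1, then its idempotents commute; if M satisfies one that holds
   in L_2^1 but fails in Q^1, then emene = emne for all idempotents e. In the
   first case M satisfies all identities of Q^1, in the second case all those
   shared by L_2^1 and Q^1, so M is in the join either way. *)

From HB Require Import structures.
From mathcomp Require Import all_boot.
From mathcomp Require Import boolp.
Require Import Defs.

Set Implicit Arguments.
Unset Strict Implicit.
Unset Printing Implicit Defensive.

Local Open Scope group_scope.

(** * First occurrences and blocks of a word *)

(* z occurs, and no y occurs before its first occurrence (y itself may be
   absent). *)
Fixpoint before (z y : nat) (w : seq nat) : bool :=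
  if w is a :: w' then (a != y) && ((a == z) || before z y w') else false.

(* The empty word when x does not occur in w. *)
Definition after (x : nat) (w : seq nat) : seq nat := drop (index x w).+1 w.

Definition linear (w : seq nat) : pred nat := fun x => count_mem x w == 1%N.

Lemma split_first (x : nat) w :
  x \in w -> exists p q, w = p ++ x :: q /\ x \notin p.
Proof.
elim: w => // a w IH; rewrite inE; case: eqVneq => [-> _|xa /= /IH].
  by exists [::], w.
by move=> [p [q [-> xp]]]; exists (a :: p), q; rewrite inE negb_or xa.
Qed.

Lemma before_cat z y p q :
  before z y (p ++ q) = before z y p || (y \notin p) && before z y q.
Proof.
elim: p => //= a p ->; rewrite inE negb_or eq_sym.
by case: (y == a); case: (a == z).
Qed.

Lemma before_notin z y w : y \notin w -> before z y w = (z \in w).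
Proof.
elim: w => //= a w IH; rewrite !inE negb_or eq_sym => /andP[-> /IH ->].
by rewrite [z == a]eq_sym.
Qed.

Lemma before_mem z y w : before z y w -> z \in w.
Proof.
elim: w => //= a w IH /andP[_ /orP[/eqP->|/IH]]; rewrite inE ?eqxx //.
by move->; rewrite orbT.
Qed.

Lemma before_skip z y s p q :  s != z -> s != y ->
  before z y (p ++ s :: q) = before z y (p ++ q).
Proof. by move=> sz sy; rewrite !before_cat /= (negPf sz) sy. Qed.

Lemma before_split z y p q : y \notin p ->
  before z y (p ++ y :: q) = (z \in p).
Proof. by move=> yp; rewrite before_cat /= eqxx andbF orbF before_notin. Qed.

Lemma after_cat x p q : x \notin p -> after x (p ++ q) = after x q.
Proof.
move=> xp; rewrite /after index_cat (negPf xp) -addnS.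
by rewrite drop_cat ltnNge leq_addr addKn.
Qed.

Lemma after_cons x s w : x != s -> after x (s :: w) = after x w.
Proof. by move=> xs; rewrite -cat1s after_cat // inE. Qed.

Lemma after_head x w : after x (x :: w) = w.
Proof. by rewrite /after /= eqxx drop0. Qed.

Lemma after_split x p q : x \notin p -> after x (p ++ x :: q) = q.
Proof. by move=> xp; rewrite after_cat // after_head. Qed.

Lemma after_notin x w : x \notin w -> after x w = [::].
Proof. by move=> xw; rewrite -[w]cats0 after_cat. Qed.

Lemma linear_split x w : linear w x ->
  exists p q, [/\ w = p ++ x :: q, x \notin p & x \notin q].
Proof.
move=> lx; have /split_first[p [q [def_w xp]]] : x \in w.
  by rewrite -has_pred1 has_count (eqP lx).
exists p, q; split=> //; move: lx; rewrite def_w /linear count_cat /= eqxx.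
by rewrite (count_memPn xp) add0n add1n eqSS => /eqP/count_memPn.
Qed.

Definition same_between (l : pred nat) (u v : seq nat) : Prop :=
  u =i v /\ forall y z, l y -> before z y u = before z y v.

Definition same_initial (u v : seq nat) : Prop :=
  forall y z, before z y u = before z y v.

(** Blocks are never cut out. Contents are compared on the stretches that run from the start or from
    a linear letter [x] up to a linear letter [y] or to the end; for neighbouring linear letters
    such a stretch is a block. Letting [z] be linear as well fixes the order of the linear
    letters. *)
Definition same_blocks (u v : seq nat) : Prop :=
  [/\ linear u =1 linear v, same_between (linear u) u v &
      forall x, linear u x -> same_between (linear u) (after x u) (after x v)].

(** For a letter [y] in neither word, [before z y] is mere occurrence of [z]. *)
Lemma same_initial_mem u v : same_initial u v -> u =i v.
Proof.
(* A number exceeding the sum of all letters is a fresh letter. *)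
move=> uv z; pose y := (sumn (u ++ v)).+1.
have yuv : y \notin u ++ v.
  apply: contraT; rewrite negbK => /split_first[p [q [def_uv _]]].
  have : y <= sumn (u ++ v) by rewrite def_uv sumn_cat /= addnCA leq_addr.
  by rewrite /y ltnn.
move: yuv; rewrite mem_cat negb_or => /andP[yu yv].
by rewrite -(before_notin _ yu) uv before_notin.
Qed.

(** * Evaluating words block by block *)

Section WordProduct.

(* The letters in l separate the blocks. The flag comm unifies the case where
   all idempotents commute with the one where a letter z commutes only with
   what follows an earlier occurrence of z. *)
Variables (M : monoidType) (g : nat -> M) (l : pred nat) (comm : bool).

Local Notation G w := (\prod_(i <- w) g i).

Hypothesis gI : forall z, ~~ l z -> g z * g z = g z.
Hypothesis gLR :
  forall z w, ~~ l z -> ~~ l w -> g z * g w * g z = g z * g w.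
Hypothesis gC : forall t z w, ~~ l z -> ~~ l w -> comm || (z \in t) ->
  G t * g z * g w = G t * g w * g z.

(** By left regularity: from z q = z q z one gets z q w z = z q z w z = z q z w = z q w, so the last
    [z] disappears whatever letters separate it from the first. *)
Lemma absorb D z : all (predC l) D -> z \in D -> G D * g z = G D.
Proof.
move=> lD /split_first[p [q [def_D _]]]; move: lD; rewrite {}def_D.
rewrite all_cat /= => /and3P[_ lz lq].
rewrite !big_cat big_cons /= -!mulgA; congr (_ * _).
elim/last_ind: q lq => [|q w IH]; first by rewrite big_nil mul1g mulg1 gI.
rewrite all_rcons => /andP[/= lw /IH {}IH].
rewrite -cats1 big_cat big_seq1 /= !mulgA; rewrite mulgA in IH.
by rewrite -IH -!mulgA (mulgA (g z) (g w)) gLR.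
Qed.

Lemma absorb_word D q : all (predC l) D -> {subset q <= D} -> G D * G q = G D.
Proof.
move=> lD; elim: q => [|z q IH] qD; first by rewrite big_nil mulg1.
rewrite big_cons mulgA absorb ?qD ?mem_head // IH // => w wq.
by rewrite qD // inE wq orbT.
Qed.

(** The letters of [q] pass into [t] one at a time, so a letter seen before stays seen; each
    exchange applies [gC] either to [s] or to the letter of [q] that it crosses. *)
Lemma swap t s q : ~~ l s -> all (predC l) q ->
    comm || (s \in t) || all (fun w => comm || (w \in t)) q ->
  G t * G q * g s = G t * g s * G q.
Proof.
move=> ls; elim: q t => [|w q IH] t /=; first by rewrite big_nil !mulg1.
move=> /andP[lw lq] old.
have -> : G t * G (w :: q) * g s = G (rcons t w) * G q * g s.
  by rewrite -cats1 big_cat big_seq1 big_cons !mulgA.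
rewrite IH //; last first.
  case/orP: old => [/orP[->//|st]|/andP[_ oq]].
    by rewrite mem_rcons inE st !orbT.
  apply/orP; right; apply: sub_all oq => x /orP[->//|xt].
  by rewrite mem_rcons inE xt !orbT.
rewrite -cats1 big_cat big_seq1 big_cons /= !mulgA; congr (_ * _).
case/orP: old => [os|/andP[ow _]]; first by rewrite [RHS]gC.
by rewrite gC.
Qed.

(* D is the part already read of the current block: the product t D absorbs its
   letters, hence the conditions on u and v only concern letters outside D. *)
Lemma eq_word_prod u : forall t D v, all (predC l) D ->
    (forall y, l y -> count_mem y u <= 1) ->
    (forall y, l y -> count_mem y v <= 1) ->
    (forall z, z \notin D -> (z \in u) = (z \in v)) ->
    (forall y z, l y -> z \notin D -> before z y u = before z y v) ->
    (forall x, l x -> same_between l (after x u) (after x v)) ->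
    (comm \/ forall y z, y \notin t ++ D -> z \notin t ++ D ->
       before z y u = before z y v) ->
  G (t ++ D) * G u = G (t ++ D) * G v.
Proof.
elim: u => [|s u IH] t D v lD cu cv con bef aft ini.
  (* Once [u] is used up, [con] puts all letters of [v] into [D], which absorbs them. *)
  rewrite !big_cat /= -!mulgA [in RHS]absorb_word ?big_nil ?mulg1 // => z zv.
  by apply: contraTT zv => /con <-.
have cu' y : l y -> count_mem y u <= 1.
  by move=> /cu; apply: leq_trans; rewrite /= leq_addl.
have [ls|lNs] := boolP (l s).
  have sD : s \notin D by apply: contraL ls => /(allP lD).
  have /split_first[q [v' [def_v sq]]] : s \in v by rewrite -con ?mem_head.
  (* Nothing precedes [s] in the first word, so by [bef] only letters of [D] may precede it in
     [v]. *)
  have qD z : z \in q -> z \in D.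
    move=> zq; apply: contraT => zD; have := bef s z ls zD.
    by rewrite def_v before_split // zq /= eqxx.
  have su : s \notin u.
    by apply/count_memPn; have := cu s ls; rewrite /= eqxx; case: count.
  have sv : s \notin v'.
    apply/count_memPn; have := cv s ls; rewrite def_v count_cat /= eqxx.
    by rewrite addnCA; case: (count _ v') => // n; rewrite !addnS.
  have lq x : l x -> x \notin q.
    by move=> lx; apply: contraL lx => /qD/(allP lD).
  have [con' bef'] := aft s ls; rewrite def_v after_head after_split // in con' bef'.
  (* A block ends here: [D] and [s] join [t], and the next block starts with nothing read. *)
  have -> : G (t ++ D) * G (s :: u) = G ((t ++ rcons D s) ++ [::]) * G u.
    by rewrite cats0 -cats1 !big_cat big_seq1 big_cons /= !mulgA.
  rewrite (IH _ _ v') //.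
  - rewrite def_v cats0 -cats1 !big_cat big_seq1 big_cons /= -!mulgA.
    by rewrite (mulgA (G D) (G q)) absorb_word.
  - by move=> y /cv; apply: leq_trans; rewrite def_v count_cat /= addnA leq_addl.
  - by move=> y z ly _; apply: bef'.
  - move=> x lx; have [->|xs] := eqVneq x s; first by rewrite !after_notin.
    have := aft x lx; rewrite def_v after_cons // after_cat ?lq //.
    by rewrite after_cons.
  case: ini => [->|ini]; [by left | right] => y z.
  rewrite cats0 !mem_cat !mem_rcons !inE !negb_or.
  move=> /and3P[yt ys yD] /and3P[zt zs zD].
  have := ini y z; rewrite !mem_cat !negb_or yt yD zt zD => /(_ isT isT).
  rewrite def_v before_skip 1?eq_sym // -[s :: u]cat0s before_skip 1?eq_sym //=.
  move=> ->; rewrite before_cat.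
  have zq : z \notin q by apply: contra zD => /qD.
  have yq : y \notin q by apply: contra yD => /qD.
  by rewrite yq before_notin // (negPf zq).
have aft_u x : l x -> after x (s :: u) = after x u.
  by move=> lx; rewrite after_cons //; apply: contraNneq lNs => <-.
have [sD|sD] := boolP (s \in D).
  have GD : G (t ++ D) * g s = G (t ++ D) by rewrite big_cat -mulgA absorb.
  rewrite big_cons mulgA GD.
  apply: IH => // [z zD|y z ly zD|x lx|].
  - by rewrite -con // inE; case: eqP => // zs; rewrite zs sD in zD.
  - rewrite -bef //= (_ : s == z = false); last by apply: contraNF zD => /eqP<-.
    by rewrite (_ : s != y) //; apply: contraNneq lNs => ->.
  - by rewrite -aft_u //; apply: aft.
  case: ini => [->|ini]; [by left | right] => y z yD zD.
  rewrite -ini //= (_ : s == z = false); last first.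
    by apply: contraNF zD => /eqP<-; rewrite mem_cat sD orbT.
  by rewrite (_ : s != y) //; apply: contraNneq yD => <-; rewrite mem_cat sD orbT.
have /split_first[q [v' [def_v sq]]] : s \in v by rewrite -con ?mem_head.
(* A separator in [q] would precede the first [s] of [v], whereas [s] comes before it in the first
   word. *)
have lq x : l x -> x \notin q.
  move=> lx; have xs : s != x by apply: contraNneq lNs => ->.
  have := bef x s lx sD; rewrite /= eqxx xs def_v before_cat /= eqxx xs /=.
  rewrite andbT; case: (x \in q) => //=; rewrite orbF => /esym/before_mem.
  by rewrite (negPf sq).
have lq' : all (predC l) q by apply/allP => x; apply: contraL => /lq.
have -> : G (t ++ D) * G (s :: u) = G (t ++ rcons D s) * G u.
  by rewrite -cats1 !big_cat big_seq1 big_cons /= !mulgA.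
rewrite (IH _ _ (q ++ v')).
(* In [v] the letter [s] is moved to the front of [q]. If only letters seen before may be moved and
   [s] is new, then [ini] shows that all letters of [q] have been seen: a new one would precede [s]
   in [v] but not in the first word. *)
- have sw : G (t ++ D) * G q * g s = G (t ++ D) * g s * G q.
    rewrite swap //; case: ini => [->//|ini].
    have [st|st] := boolP (s \in t); first by rewrite mem_cat st !orbT.
    apply/orP; right; apply/allP => w wq; apply/orP; right; apply: contraT => wt.
    have := ini s w; rewrite {1}mem_cat (negPf st) (negPf sD) => /(_ isT wt).
    by rewrite def_v before_split // wq /= eqxx.
  have <- : G (t ++ D) * g s = G (t ++ rcons D s).
    by rewrite -cats1 catA [RHS]big_cat big_seq1.
  by rewrite def_v [G (q ++ _)]big_cat [G (q ++ _)]big_cat big_cons !mulgA sw.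
- by rewrite all_rcons /= lNs.
- exact: cu'.
- by move=> y /cv; apply: leq_trans; rewrite def_v !count_cat leq_add2l leq_addl.
- move=> z; rewrite mem_rcons inE negb_or => /andP[zs /con].
  by rewrite def_v !mem_cat !inE (negPf zs).
- move=> y z ly; rewrite mem_rcons inE negb_or => /andP[zs /(bef y z ly)].
  have ys : y != s by apply: contraNneq lNs => <-.
  by rewrite def_v (@before_skip z y s q v') 1?eq_sym //
    (@before_skip z y s [::] u) 1?eq_sym.
- move=> x lx; have := aft x lx; rewrite aft_u // def_v !after_cat ?lq //.
  by rewrite after_cons //; apply: contraNneq lNs => <-.
case: ini => [->|ini]; [by left | right] => y z.
rewrite !mem_cat !mem_rcons !inE !negb_or.
move=> /and3P[yt ys yD] /and3P[zt zs zD].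
have := ini y z; rewrite !mem_cat !negb_or yt yD zt zD => /(_ isT isT).
by rewrite def_v (@before_skip z y s q v') 1?eq_sym //
    (@before_skip z y s [::] u) 1?eq_sym.
Qed.

End WordProduct.

(** * Conditions on a monoid *)

Definition regular_monoid (M : monoidType) : Prop :=
  [/\ forall x h : M, x * h * x = x * x * h * x,
      forall x h : M, x * h * x = x * h * x * x &
      forall x y : M, x * x * (y * y) * (x * x) = x * x * (y * y)].

Definition idempotents_commute (M : monoidType) : Prop :=
  forall e f : M, e * e = e -> f * f = f -> e * f = f * e.

Definition middle_cancel (M : monoidType) : Prop :=
  forall e m n : M, e * e = e -> e * m * e * n * e = e * m * n * e.

Lemma satisfies_sym (M : monoidType) u v :
  satisfies M (u, v) -> satisfies M (v, u).
Proof. by move=> uv f; apply/esym/uv. Qed.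

Lemma prod_idem (M : monoidType) (f : nat -> M) z w :
    f z * f z = f z -> (forall i, i \in w -> i != z -> f i = 1) ->
  \prod_(i <- w) f i = if z \in w then f z else 1.
Proof.
move=> fz; elim: w => [|a w IH] f1; first by rewrite big_nil.
rewrite big_cons inE IH => [|i iw]; last by apply: f1; rewrite inE iw orbT.
have [<-|za] /= := eqVneq z a; first by case: ifP; rewrite ?mulg1 ?fz.
by rewrite f1 ?mem_head 1?eq_sym // mul1g.
Qed.

(** * Monoids of var(E^1) *)

Section RegularMonoid.

Variable M : monoidType.
Hypothesis regM : regular_monoid M.

Lemma cube_square (x : M) : x * x * x = x * x.
Proof. by case: regM => /(_ x 1); rewrite !mulg1 => <-. Qed.

Lemma square_idem (x : M) : x * x * (x * x) = x * x.
Proof. by rewrite mulgA !cube_square. Qed.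

Lemma idem_left_regular (e f : M) :
  e * e = e -> f * f = f -> e * f * e = e * f.
Proof. by case: regM => _ _ /(_ e f) + ee ff; rewrite ee ff. Qed.

Lemma prod_double u (f : nat -> M) :
  \prod_(i <- u) f i =
    \prod_(i <- u) (if linear u i then f i else f i * f i).
Proof.
set g := fun i => if linear u i then f i else f i * f i.
(* Letters are squared from left to right, [p] being the part already treated. *)
suff E p q : u = p ++ q ->
    \prod_(i <- p) g i * \prod_(i <- q) f i = \prod_(i <- u) f i.
  by have := E u [::]; rewrite cats0 big_nil mulg1 => ->.
case: regM => double_l double_r _.
elim/last_ind: p q => [|p s IH] q def_u; first by rewrite big_nil mul1g def_u.
rewrite -cats1 -catA in def_u; rewrite -(IH _ def_u) -cats1 big_cat big_seq1 /=.
rewrite big_cons -mulgA [g s]/g; case: ifP => // sN1.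
(* A nonlinear [s] occurs again in [q], where xhx = xxhx squares the present occurrence, or it
   occurred in [p], where xhx = xhxx does. *)
have [sq|sq] := boolP (s \in q).
  have [q1 [q2 [-> _]]] := split_first sq.
  rewrite big_cat big_cons /= !mulgA; congr (_ * _); rewrite -!mulgA.
  by congr (_ * _); rewrite !mulgA -double_l.
have sp : s \in p.
  apply: contraFT sN1 => sp; rewrite /linear def_u count_cat /= eqxx.
  by rewrite (count_memPn sp) (count_memPn sq).
have [p1 [p2 [-> _]]] := split_first sp.
rewrite big_cat big_cons /= [g s]/g sN1 -!mulgA.
by congr (_ * (_ * _)); rewrite !mulgA -double_r.
Qed.

(** Squaring the nonlinear letters makes them idempotent, so [eq_word_prod] applies with the linear
    letters as separators. *)
Lemma satisfies_same_blocks u v : same_blocks u v ->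
  idempotents_commute M \/ middle_cancel M /\ same_initial u v ->
  satisfies M (u, v).
Proof.
move=> [lin uv aft] hM f /=; rewrite prod_double [RHS]prod_double.
under [RHS]eq_bigr do rewrite -lin.
set g := fun i => if linear u i then f i else f i * f i.
have gI z : ~~ linear u z -> g z * g z = g z.
  by rewrite /g => /negPf ->; apply: square_idem.
pose comm := `[< idempotents_commute M >].
have gC (t : seq nat) z w : ~~ linear u z -> ~~ linear u w ->
    comm || (z \in t) ->
  \prod_(i <- t) g i * g z * g w = \prod_(i <- t) g i * g w * g z.
  move=> lz lw /orP[/asboolP Mcom|zt].
    by rewrite -!mulgA; congr (_ * _); apply: Mcom; apply: gI.
  case: hM => [Mcom|[Mmid _]].
    by rewrite -!mulgA; congr (_ * _); apply: Mcom; apply: gI.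
  have [t1 [t2 [-> _]]] := split_first zt.
  rewrite big_cat big_cons /= -!mulgA; congr (_ * _).
  (* With e = g z, m the product over [t2] and n = g w, middle cancellation and ene = en give emen =
     emene = emne. *)
  have zw : g z * (g w * g z) = g z * g w.
    by rewrite mulgA idem_left_regular // gI.
  have := Mmid (g z) (\prod_(i <- t2) g i) (g w) (gI z lz).
  by rewrite -!mulgA zw.
have := @eq_word_prod M g (linear u) comm gI _ gC u [::] [::] v.
rewrite big_nil !mul1g; apply=> //.
- by move=> z w lz lw; apply: idem_left_regular; apply: gI.
- by move=> y /eqP->.
- by move=> y; rewrite lin => /eqP->.
- by move=> z _; case: uv => ->.
- by move=> y z ly _; case: uv => _; apply.
case: hM => [Mcom|[_ ini]]; first by left; apply/asboolP.
by right=> y z _ _; apply: ini.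
Qed.

(** Without separators the whole word is one block. In a left regular band a letter seen before can
    be erased, hence moved. *)
Lemma satisfies_same_initial u v :
    same_initial u v -> (forall m : M, m * m = m) ->
  satisfies M (u, v).
Proof.
move=> uv MI f; have MLR (e h : M) : e * h * e = e * h.
  by apply: idem_left_regular.
have := @eq_word_prod M f pred0 false (fun z _ => MI _) (fun z w _ _ => MLR _ _)
  _ u [::] [::] v.
rewrite big_nil !mul1g; apply=> //.
- move=> t z w _ _ /split_first[t1 [t2 [-> _]]].
  rewrite big_cat big_cons /= -!mulgA; congr (_ * _); rewrite !mulgA.
  set x := \prod_(i <- t2) f i; rewrite MLR.
  by rewrite -[f z * x * f w]mulgA MLR.
- by move=> z _; rewrite (same_initial_mem uv).
by right=> y z _ _; apply: uv.
Qed.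

(** Sending all letters but [x] to 1 leaves m = m^k with k different from 1. For k = 0 this is m =
    1; otherwise m is a power with exponent at least 2, and all these equal the idempotent m^2. *)
Lemma not_linear_idem u v x : satisfies M (u, v) ->
  linear u x -> ~~ linear v x -> forall m : M, m * m = m.
Proof.
move=> Muv ux vx m; pose f i := if i == x then m else 1.
have prodf w : \prod_(i <- w) f i = m ^+ count_mem x w.
  elim: w => [|a w IH]; first by rewrite big_nil.
  rewrite big_cons IH /f /=; case: eqP => _; first by rewrite -expgS.
  by rewrite mul1g.
have := Muv f; rewrite /= !prodf (eqP ux) expg1 => def_m.
move: vx def_m; rewrite /linear; case: count => [|[|k]] // _ ->.
  by rewrite mulg1.
elim: k => [|k IH]; first by rewrite expgS expg1 square_idem.
suff -> : m ^+ k.+3 = m ^+ k.+2 by [].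
rewrite [LHS]expgS [in LHS]expgS [in LHS]expgS !mulgA.
by rewrite cube_square -mulgA -!expgS.
Qed.

Lemma idem_middle_cancel : (forall m : M, m * m = m) -> middle_cancel M.
Proof.
move=> MI e m n _; have MLR (x y : M) : x * y * x = x * y.
  by apply: idem_left_regular.
by rewrite MLR -[e * m * n]mulgA MLR mulgA.
Qed.

(** If the words disagree on whether [z] precedes [y], sending z to f, y to e and all else to 1
    makes the idempotents e and f commute. *)
Lemma same_initial_of_satisfies u v :
  ~ idempotents_commute M -> satisfies M (u, v) -> same_initial u v.
Proof.
move=> Mcom Muv y z; apply: contra_notP Mcom => /eqP.
wlog uz : u v Muv / before z y u && ~~ before z y v.
  move=> W uv; have [uz|uz] := boolP (before z y u); last first.
    apply: (W v u); [exact: satisfies_sym | | by rewrite eq_sym].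
    by move: uv; rewrite (negPf uz); case: before.
  by apply: (W u v) => //; move: uv; rewrite uz; case: before.
case/andP: uz => uz vz _ e f ee ff.
have yz : y != z.
  by apply: contraTneq uz => ->; elim: u {Muv} => //= a u; case: (a == z).
pose g i := if i == z then f else if i == y then e else 1.
(* By left regularity the product depends only on which of the two letters comes first; the final
   factor [e * f] ensures that both are present, also when [w] contains neither. *)
have prodg w : \prod_(i <- w) g i * (e * f) =
    if before z y w then f * e else e * f.
  elim: w => [|a w IH]; first by rewrite big_nil mul1g.
  rewrite big_cons -mulgA IH {IH} /g /= [a == y]eq_sym.
  have [->|az] := eqVneq a z.
    rewrite yz /=; case: before; first by rewrite mulgA ff.
    by rewrite mulgA idem_left_regular.
  have [->|ay] := eqVneq y a; last by rewrite mul1g.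
  rewrite /=; case: before; last by rewrite mulgA ee.
  by rewrite mulgA idem_left_regular.
by have := prodg u; rewrite [\prod_(i <- u) _]Muv prodg uz (negPf vz).
Qed.

(** Send z to e, x to m and all else to 1, then multiply by e on the left and by n e on the right.
    Only the side with [z] after [x] keeps an e between m and n; further copies of e merge with the
    outer ones. *)
Lemma middle_cancel_last x z p q p' q' :
    satisfies M (p ++ x :: q, p' ++ x :: q') ->
    x \notin p ++ q -> x \notin p' ++ q' -> z \in q -> z \notin q' ->
  middle_cancel M.
Proof.
move=> Muv; rewrite !mem_cat !negb_or => /andP[xp xq] /andP[xp' xq'] zq zq'.
move=> e m n ee.
have xz : x != z by apply: contraNneq xq => ->.
pose f i := if i == z then e else if i == x then m else 1.
have fz : f z = e by rewrite /f eqxx.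
have prodf w : x \notin w -> \prod_(i <- w) f i = if z \in w then e else 1.
  move=> xw; rewrite (@prod_idem _ f z) ?fz // => i iw /negPf iz; rewrite /f iz.
  by case: eqP => // ix; rewrite -ix iw in xw.
have := congr1 (fun t => e * t * n * e) (Muv f); rewrite /=.
rewrite !big_cat !big_cons /= !prodf // zq (negPf zq').
have fx : f x = m by rewrite /f (negPf xz) eqxx.
by rewrite fx mulg1 !mulgA; do 2!case: ifP => _; rewrite ?mulg1 ?ee.
Qed.

(** As for [middle_cancel_last], except that n is now the value of the second linear letter [y]. *)
Lemma middle_cancel_between x y z p q r p' q' r' :
    satisfies M (p ++ x :: q ++ y :: r, p' ++ x :: q' ++ y :: r') ->
    x != y -> x \notin p ++ q ++ r -> x \notin p' ++ q' ++ r' ->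
    y \notin p ++ q ++ r -> y \notin p' ++ q' ++ r' ->
    z \in q -> z \notin q' ->
  middle_cancel M.
Proof.
move=> Muv xy; rewrite !mem_cat !negb_or.
move=> /and3P[xp xq xr] /and3P[xp' xq' xr'].
move=> /and3P[yp yq yr] /and3P[yp' yq' yr'].
move=> zq zq' e m n ee.
have xz : x != z by apply: contraNneq xq => ->.
have yz : y != z by apply: contraNneq yq => ->.
pose f i := if i == z then e else if i == x then m else if i == y then n else 1.
have fz : f z = e by rewrite /f eqxx.
have prodf w : x \notin w -> y \notin w ->
    \prod_(i <- w) f i = if z \in w then e else 1.
  move=> xw yw; rewrite (@prod_idem _ f z) ?fz // => i iw /negPf iz.
  rewrite /f iz; case: eqP => [ix|_]; first by rewrite -ix iw in xw.
  by case: eqP => // iy; rewrite -iy iw in yw.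
have := congr1 (fun t => e * t * e) (Muv f); rewrite /=.
rewrite !(big_cat, big_cons) /= !prodf // zq (negPf zq').
have fx : f x = m by rewrite /f (negPf xz) eqxx.
have fy : f y = n by rewrite /f (negPf yz) eq_sym (negPf xy) eqxx.
rewrite fx fy mul1g !mulgA.
by do 4!case: ifP => _; rewrite ?mulg1 -?[_ * e * e]mulgA ?ee.
Qed.

Lemma same_blocks_of_satisfies u v :
  ~ middle_cancel M -> satisfies M (u, v) -> same_initial u v ->
  same_blocks u v.
Proof.
move=> Mmid Muv ini.
have linS w w' x : satisfies M (w, w') -> linear w x -> linear w' x.
  move=> Mww' wx; apply: contra_notT Mmid => wx'.
  exact/idem_middle_cancel/(not_linear_idem Mww' wx wx').
have lin : linear u =1 linear v.
  move=> x; apply/idP/idP; apply: linS => //; exact: satisfies_sym.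
split=> // [|x ux].
  (* Stretches from the start of the words are governed by [same_initial]; the rest of the proof
     treats those that start after [x]. *)
  by split=> [|y z _]; [apply: same_initial_mem | apply: ini].
have [p [q [def_u xp xq]]] := linear_split ux.
have [p' [q' [def_v xp' xq']]] : exists p q,
    [/\ v = p ++ x :: q, x \notin p & x \notin q].
  by apply: linear_split; rewrite -lin.
rewrite {2}def_u def_v !after_split //.
have con : q =i q'.
  move=> z; apply/idP/idP => zq; apply: contra_notT Mmid => zq'.
    apply: (@middle_cancel_last x z p q p' q') => //; rewrite ?mem_cat ?negb_or.
    - by rewrite -def_u -def_v.
    - by rewrite xp.
    by rewrite xp'.
  apply: (@middle_cancel_last x z p' q' p q) => //; rewrite ?mem_cat ?negb_or.
  - by rewrite -def_u -def_v; apply: satisfies_sym.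
  - by rewrite xp'.
  by rewrite xp.
(* If [y] is absent from [q], the stretch runs to the end and [con] settles it; otherwise
   [middle_cancel_between] applies. *)
split=> // y z uy; have [yq|yq] := boolP (y \in q); last first.
  by rewrite !before_notin // -con.
have xy : x != y by apply: contraNneq xq => ->.
have linE w a b c : linear w y -> w = a ++ x :: b ++ y :: c ->
    y \notin a ++ b ++ c.
  move=> wy def_w; apply/count_memPn; move: wy; rewrite /linear def_w.
  rewrite !count_cat /= count_cat /= eqxx (negPf xy) add0n add1n !addnS.
  by move=> /eqP[].
have yq' : y \in q' by rewrite -con.
have [q1 [q2 [def_q yq1]]] := split_first yq.
have [q1' [q2' [def_q' yq1']]] := split_first yq'.
rewrite def_q def_q' !before_split //.
rewrite def_q in def_u xq; rewrite def_q' in def_v xq'.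
have vy : linear v y by rewrite -lin.
have yu := linE _ _ _ _ uy def_u; have yv := linE _ _ _ _ vy def_v.
move: xq xq'; rewrite !mem_cat !inE !negb_or.
move=> /and3P[xq1 _ xq2] /and3P[xq1' _ xq2'].
have xu : x \notin p ++ q1 ++ q2 by rewrite !mem_cat !negb_or xp xq1.
have xv : x \notin p' ++ q1' ++ q2' by rewrite !mem_cat !negb_or xp' xq1'.
apply/idP/idP => zq; apply: contra_notT Mmid => zq'.
  apply: (middle_cancel_between _ xy xu xv yu yv zq zq').
  by rewrite -def_u -def_v.
apply: (middle_cancel_between _ xy xv xu yv yu zq zq').
by rewrite -def_u -def_v; apply: satisfies_sym.
Qed.

End RegularMonoid.

(** * The presented semigroups *)

Section Model.

Variables (A : choiceType) (R : word A -> word A -> Prop).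
Variables (C : Type) (op : C -> C -> C) (h : A -> C).

Local Notation S := (presented R).
Local Notation pi w := (\pi_(S)%qT w).

Hypothesis opA : associative op.

Definition word_eval (w : word A) : C :=
  foldl (fun c x => op c (h x)) (h w.1) w.2.

Lemma word_evalM u v : word_eval (u * v) = op (word_eval u) (word_eval v).
Proof.
rewrite /word_eval /= foldl_cat /=; set c := foldl _ _ u.2.
by elim/last_ind: v.2 => //= s x IH; rewrite -!cats1 !foldl_cat /= IH opA.
Qed.

Hypothesis evalR : forall u v, R u v -> word_eval u = word_eval v.

Lemma word_eval_cong u v : cong_gen R u v -> word_eval u = word_eval v.
Proof.
elim=> // {u v} [u v w _ -> _ ->//|u u' v v' _ Eu _ Ev].
by rewrite !word_evalM Eu Ev.
Qed.

Definition presented_eval (x : S) : C := word_eval (repr x).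

Lemma presented_eval_pi w : presented_eval (pi w) = word_eval w.
Proof.
apply: word_eval_cong; apply/asboolP.
by rewrite -[`[< _ >]]/(cong_gen_equiv R _ _) -eqmodE reprK.
Qed.

Lemma piM u v : pi u * pi v = pi (u * v) :> S.
Proof. exact: presented_mulE. Qed.

Lemma presented_evalM x y :
  presented_eval (x * y) = op (presented_eval x) (presented_eval y).
Proof.
by rewrite -[x]reprK -[y]reprK piM !presented_eval_pi word_evalM.
Qed.

Variable rep : C -> S.
Hypothesis rep_gen : forall x, rep (h x) = pi (gen x).
Hypothesis rep_op : forall c x, rep c * pi (gen x) = rep (op c (h x)).

(** The values of [rep] serve as normal forms: they contain the generators and are closed under
    right multiplication by them, hence exhaust the presented semigroup. Its elements are therefore
    determined by their values in the table. *)
Lemma presented_evalK : cancel presented_eval rep.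
Proof.
move=> x; rewrite -[x in RHS]reprK /presented_eval.
case: (repr x) => a s; rewrite /word_eval /=.
elim/last_ind: s => [|s b IH]; first exact: rep_gen.
rewrite -cats1 foldl_cat /= -rep_op IH piM; congr (pi _).
Qed.

Definition adjoin1_op (x y : option C) : option C :=
  match x, y with
  | None, _ => y
  | _, None => x
  | Some s, Some t => Some (op s t)
  end.

Definition adjoin1_eval (x : adjoin1 S) : option C := omap presented_eval x.

Lemma adjoin1_eval_inj : injective adjoin1_eval.
Proof.
by move=> [x|] [y|] //= [] /(can_inj presented_evalK) ->.
Qed.

Lemma adjoin1_evalM x y :
  adjoin1_eval (x * y) = adjoin1_op (adjoin1_eval x) (adjoin1_eval y).
Proof. by case: x y => [x|] [y|] //=; rewrite -presented_evalM. Qed.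

Lemma adjoin1_eval_gen x : adjoin1_eval (Some (pi (gen x))) = Some (h x).
Proof. by rewrite /= presented_eval_pi. Qed.

End Model.

(** * Multiplication tables of E, Q and L_2 *)

Lemma I3_ind (P : 'I_3 -> Prop) :
  P let0 -> P let1 -> P let2 -> forall i, P i.
Proof.
move=> P0 P1 P2 [[|[|[|i]]] lti] //.
- by rewrite (_ : Ordinal lti = let0) //; apply: val_inj.
- by rewrite (_ : Ordinal lti = let1) //; apply: val_inj.
by rewrite (_ : Ordinal lti = let2) //; apply: val_inj.
Qed.

Inductive five := Fa | Fb | Fc | Fd | F0.

Definition five_gen (x : option 'I_3) : five :=
  match x with
  | Some i => match val i with 0 => Fa | 1 => Fb | _ => Fc end
  | None => F0
  end.

(* In E the fifth element Fd is ac, in Q it is bc. *)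
Definition E_mul (x y : five) : five :=
  match x, y with
  | F0, _ | _, F0 | Fa, (Fa | Fb | Fd) | Fd, (Fa | Fd) => F0
  | Fa, Fc | Fd, _ => Fd
  | Fb, (Fb | Fc) => Fb
  | Fc, (Fb | Fc) => Fc
  | _, _ => y
  end.

Definition Q_mul (x y : five) : five :=
  match x, y with
  | Fa, (Fa | Fb | Fd) => y
  | Fb, Fc => Fd
  | (Fc | Fd), Fa => x
  | _, _ => F0
  end.

Lemma E_mulA : associative E_mul. Proof. by case; case; case. Qed.
Lemma Q_mulA : associative Q_mul. Proof. by case; case; case. Qed.

Lemma with_zero_eval (s : seq (word (option 'I_3) * word (option 'I_3))) op :
    associative op -> left_zero F0 op -> right_zero F0 op ->
    (forall u v, (u, v) \in s ->
       word_eval op five_gen u = word_eval op five_gen v) ->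
  forall u v, with_zero (rels s) u v ->
    word_eval op five_gen u = word_eval op five_gen v.
Proof.
move=> opA op0x opx0 ops u v [/ops //|[w [[] -> ->]]].
  by rewrite word_evalM.
by rewrite word_evalM.
Qed.

Section ZeroPresentation.

Variable s : seq (word (option 'I_3) * word (option 'I_3)).

Local Notation S := (presented (with_zero (rels s))).
Local Notation pi w := (\pi_(S)%qT w).

Definition zero_let (x : option 'I_3) : S := pi (gen x).

Lemma zero_letM u v : (u, v) \in s -> pi u = pi v.
Proof. by move=> suv; apply/eqmodP/asboolP/cong_rel; left. Qed.

Lemma zero_let_mul0 (x : S) : x * zero_let None = zero_let None.
Proof.
rewrite -[x]reprK piM; apply/eqmodP/asboolP/cong_rel; right.
by exists (repr x); split=> //; right.
Qed.

Lemma zero_let_0mul (x : S) : zero_let None * x = zero_let None.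
Proof.
rewrite -[x]reprK piM; apply/eqmodP/asboolP/cong_rel; right.
by exists (repr x); split=> //; left.
Qed.

End ZeroPresentation.

Section FiveRep.

Variable s : seq (word (option 'I_3) * word (option 'I_3)).
Variable d : presented (with_zero (rels s)).

Definition five_rep (c : five) : presented (with_zero (rels s)) :=
  match c with
  | Fa => zero_let s (Some let0)
  | Fb => zero_let s (Some let1)
  | Fc => zero_let s (Some let2)
  | Fd => d
  | F0 => zero_let s None
  end.

Lemma five_rep_gen x : five_rep (five_gen x) = zero_let s x.
Proof. by case: x => [i|] //; elim/I3_ind: i. Qed.

End FiveRep.

Local Notation Elet i := (zero_let E_rels (Some i)).
Local Notation Qlet i := (zero_let Q_rels (Some i)).

Lemma E_relP : [/\ Elet let0 * Elet let0 = zero_let E_rels None,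
  Elet let0 * Elet let1 = zero_let E_rels None,
  Elet let1 * Elet let0 = Elet let0 & Elet let2 * Elet let0 = Elet let0] /\
  [/\ Elet let1 * Elet let1 = Elet let1, Elet let1 * Elet let2 = Elet let1,
  Elet let2 * Elet let2 = Elet let2 & Elet let2 * Elet let1 = Elet let2].
Proof.
by split; split; rewrite /zero_let piM; apply: zero_letM; rewrite !inE eqxx ?orbT.
Qed.

Lemma Q_relP : [/\ Qlet let0 * Qlet let0 = Qlet let0,
  Qlet let0 * Qlet let1 = Qlet let1 & Qlet let2 * Qlet let0 = Qlet let2] /\
  [/\ Qlet let0 * Qlet let2 = zero_let Q_rels None,
  Qlet let1 * Qlet let0 = zero_let Q_rels None &
  Qlet let2 * Qlet let1 = zero_let Q_rels None].
Proof.
by split; split; rewrite /zero_let piM; apply: zero_letM; rewrite !inE eqxx ?orbT.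
Qed.

Definition E_rep := five_rep (Elet let0 * Elet let2).
Definition Q_rep := five_rep (Qlet let1 * Qlet let2).

Lemma E_rep_mul c x : E_rep c * zero_let E_rels x = E_rep (E_mul c (five_gen x)).
Proof.
case: E_relP => -[aa ab ba ca] [bb bc cc cb].
case: x => [i|]; last by rewrite zero_let_mul0; case: c.
elim/I3_ind: i; case: c => /=;
  rewrite ?zero_let_0mul -?mulgA ?aa ?ab ?ba ?ca ?bb ?bc ?cc ?cb ?aa //.
Qed.

Lemma Q_rep_mul c x : Q_rep c * zero_let Q_rels x = Q_rep (Q_mul c (five_gen x)).
Proof.
case: Q_relP => -[aa ab ca] [ac ba cb].
(* Two consequences of the relations: bb = b(ab) = (ba)b = 0 and cc = (ca)c = c(ac) = 0. *)
have bb : Qlet let1 * Qlet let1 = zero_let Q_rels None.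
  by rewrite -{2}ab mulgA ba zero_let_0mul.
have cc : Qlet let2 * Qlet let2 = zero_let Q_rels None.
  by rewrite -{1}ca -mulgA ac zero_let_mul0.
case: x => [i|]; last by rewrite zero_let_mul0; case: c.
by elim/I3_ind: i; case: c => /=;
  rewrite ?zero_let_0mul -?mulgA ?aa ?ab ?ba ?ca ?bb ?ac ?cc ?cb ?zero_let_mul0.
Qed.

Lemma E_evalR u v : with_zero (rels E_rels) u v ->
  word_eval E_mul five_gen u = word_eval E_mul five_gen v.
Proof.
apply: with_zero_eval; [exact: E_mulA | by case | by case |].
move=> {}u {}v; rewrite !inE.
by do ?[case/orP] => /eqP[-> ->].
Qed.

Lemma Q_evalR u v : with_zero (rels Q_rels) u v ->
  word_eval Q_mul five_gen u = word_eval Q_mul five_gen v.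
Proof.
apply: with_zero_eval; [exact: Q_mulA | by case | by case |].
move=> {}u {}v; rewrite !inE.
by do ?[case/orP] => /eqP[-> ->].
Qed.

(** Injectivity reduces equations in S^1 to a case check in the table; the last clause provides the
    elements for counterexamples. *)
Definition faithful_table (S : semigroupType) (A C : Type) (op : C -> C -> C)
    (h : A -> C) : Prop :=
  exists phi : adjoin1 S -> option C,
    [/\ injective phi, {morph phi : x y / x * y >-> adjoin1_op op x y} &
        forall x, exists m, phi m = Some (h x)].

Lemma presented_table (A : choiceType) (R : word A -> word A -> Prop)
    (C : Type) (op : C -> C -> C) (h : A -> C) (rep : C -> presented R) :
    associative op ->
    (forall u v, R u v -> word_eval op h u = word_eval op h v) ->
    (forall x, rep (h x) = \pi_(presented R)%qT (gen x)) ->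
    (forall c x, rep c * \pi_(presented R)%qT (gen x) = rep (op c (h x))) ->
  faithful_table (presented R) op h.
Proof.
move=> opA evalR rep_gen rep_op.
exists (@adjoin1_eval A R C op h); split.
- exact: adjoin1_eval_inj rep_gen rep_op.
- exact: adjoin1_evalM.
by move=> x; exists (Some (\pi_(presented R)%qT (gen x))); apply: adjoin1_eval_gen.
Qed.

Lemma E_table : faithful_table sgE E_mul five_gen.
Proof.
exact: presented_table E_mulA E_evalR (five_rep_gen _) E_rep_mul.
Qed.

Lemma Q_table : faithful_table sgQ Q_mul five_gen.
Proof.
exact: presented_table Q_mulA Q_evalR (five_rep_gen _) Q_rep_mul.
Qed.

Lemma L2_table : faithful_table sgL2 (fun x _ : bool => x) id.
Proof.
apply: (@presented_table _ _ _ _ _ (fun c => \pi_(sgL2)%qT (gen c))) => //.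
  move=> u v; rewrite /rels !inE.
  by do ?[case/orP] => /eqP[-> ->].
move=> c x; rewrite piM; apply/eqmodP/asboolP/cong_rel.
by case: c x => [] []; rewrite /rels !inE eqxx ?orbT.
Qed.

(** * Properties of E^1, Q^1 and L_2^1 read off their tables *)

Lemma regular_table (S : semigroupType) (A C : Type) (op : C -> C -> C)
    (h : A -> C) : faithful_table S op h ->
  let mul := adjoin1_op op in
  (forall x y, [/\ mul (mul x y) x = mul (mul (mul x x) y) x,
     mul (mul x y) x = mul (mul (mul x y) x) x &
     mul (mul (mul x x) (mul y y)) (mul x x) = mul (mul x x) (mul y y)]) ->
  regular_monoid (adjoin1 S).
Proof.
move=> [phi [phiI phiM _]] mul H.
by split=> x y; apply: phiI; rewrite !phiM; case: (H (phi x) (phi y)).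
Qed.

Lemma E1_regular : regular_monoid (adjoin1 sgE).
Proof. by apply: regular_table E_table _; do 2 case=> [[]|]. Qed.

Lemma Q1_regular : regular_monoid (adjoin1 sgQ).
Proof. by apply: regular_table Q_table _; do 2 case=> [[]|]. Qed.

Lemma L21_regular : regular_monoid (adjoin1 sgL2).
Proof. by apply: regular_table L2_table _; do 2 case=> [[]|]. Qed.

Lemma E1_not_commute : ~ idempotents_commute (adjoin1 sgE).
Proof.
have [phi [phiI phiM phih]] := E_table.
have [[b Eb] [c Ec]] := (phih (Some let1), phih (Some let2)).
move=> /(_ b c) bc; suff /(congr1 phi): b * c = c * b by rewrite !phiM Eb Ec.
by apply: bc; apply: phiI; rewrite phiM ?Eb ?Ec.
Qed.

Lemma L21_not_commute : ~ idempotents_commute (adjoin1 sgL2).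
Proof.
have [phi [phiI phiM phih]] := L2_table.
have [[b Eb] [c Ec]] := (phih true, phih false).
move=> /(_ b c) bc; suff /(congr1 phi): b * c = c * b by rewrite !phiM Eb Ec.
by apply: bc; apply: phiI; rewrite phiM ?Eb ?Ec.
Qed.

(** Here cacbc = ac, while cabc = 0. *)
Lemma E1_not_cancel : ~ middle_cancel (adjoin1 sgE).
Proof.
have [phi [phiI phiM phih]] := E_table.
have [[a Ea] [[b Eb] [c Ec]]] :=
  (phih (Some let0), (phih (Some let1), phih (Some let2))).
move=> /(_ c a b) H.
suff /(congr1 phi): c * a * c * b * c = c * a * b * c.
  by rewrite !phiM Ea Eb Ec.
by apply: H; apply: phiI; rewrite phiM Ec.
Qed.

(** Here abaca = 0, while abca = bc. *)
Lemma Q1_not_cancel : ~ middle_cancel (adjoin1 sgQ).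
Proof.
have [phi [phiI phiM phih]] := Q_table.
have [[a Ea] [[b Eb] [c Ec]]] :=
  (phih (Some let0), (phih (Some let1), phih (Some let2))).
move=> /(_ a b c) H.
suff /(congr1 phi): a * b * a * c * a = a * b * c * a.
  by rewrite !phiM Ea Eb Ec.
by apply: H; apply: phiI; rewrite phiM Ea.
Qed.

(** The idempotents are 1, a and 0. *)
Lemma Q1_commute : idempotents_commute (adjoin1 sgQ).
Proof.
have [phi [phiI phiM phih]] := Q_table.
move=> e f /(congr1 phi) + /(congr1 phi); rewrite !phiM => ee ff.
apply: phiI; rewrite !phiM.
by case: (phi e) (phi f) ee ff => [[]|] [[]|].
Qed.

Lemma L21_idem (m : adjoin1 sgL2) : m * m = m.
Proof.
have [phi [phiI phiM _]] := L2_table.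
by apply: phiI; rewrite phiM; case: (phi m).
Qed.

Lemma L21_satisfies u v : satisfies (adjoin1 sgL2) (u, v) <-> same_initial u v.
Proof.
split=> [Muv|]; first
  exact (same_initial_of_satisfies L21_regular L21_not_commute Muv).
by move=> uv; exact (satisfies_same_initial L21_regular uv L21_idem).
Qed.

Lemma Q1_satisfies u v : same_blocks u v -> satisfies (adjoin1 sgQ) (u, v).
Proof.
by move=> uv; apply: (satisfies_same_blocks Q1_regular uv); left; apply: Q1_commute.
Qed.

(** * The varieties and their identities *)

Definition regular_identities : seq identity :=
  [:: ([:: 0; 1; 0], [:: 0; 0; 1; 0]); ([:: 0; 1; 0], [:: 0; 1; 0; 0]);
      ([:: 0; 0; 1; 1; 0; 0], [:: 0; 0; 1; 1])]%N.

Lemma regular_monoidP (M : monoidType) :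
  regular_monoid M <-> forall e, e \in regular_identities -> satisfies M e.
Proof.
split=> [[H1 H2 H3] e|H].
  rewrite !inE => /or3P[] /eqP-> f; rewrite !(big_cons, big_nil) !mulg1 /= ?mulgA.
  - exact: H1.
  - exact: H2.
  by have := H3 (f 0%N) (f 1%N); rewrite !mulgA.
have {}H e (x y : M) : e \in regular_identities ->
    \prod_(i <- e.1) (if i == 0%N then x else y) =
    \prod_(i <- e.2) (if i == 0%N then x else y) by move=> /H; apply.
split=> x y.
- have := H (nth ([::], [::]) regular_identities 0%N) x y isT.
  by rewrite !(big_cons, big_nil) !mulg1 /= ?mulgA.
- have := H (nth ([::], [::]) regular_identities 1%N) x y isT.
  by rewrite !(big_cons, big_nil) !mulg1 /= ?mulgA.
have := H (nth ([::], [::]) regular_identities 2%N) x y isT.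
by rewrite !(big_cons, big_nil) !mulg1 /= ?mulgA.
Qed.

Lemma variety_identity e : is_variety (fun M => satisfies M e).
Proof. by exists (eq e) => M; split=> [Me _ <-|]; last exact. Qed.

Lemma varE1_satisfies M e :
  varE1 M -> satisfies (adjoin1 sgE) e -> satisfies M e.
Proof. by move=> EM Ee; apply: EM (variety_identity e) _ => _ ->. Qed.

Lemma varE1_regular M : varE1 M -> regular_monoid M.
Proof.
move=> EM; apply/regular_monoidP => e regE.
by apply: varE1_satisfies EM _; apply/regular_monoidP: e regE; apply: E1_regular.
Qed.

Lemma vjoin_satisfies M u v : vjoin varL21 varQ1 M ->
  same_initial u v -> same_blocks u v -> satisfies M (u, v).
Proof.
move=> JM Luv Quv; have Vuv := variety_identity (u, v).
apply: (JM _ Vuv) => N [] /(_ _ Vuv).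
  by apply=> _ ->; apply/L21_satisfies.
by apply=> _ ->; apply: Q1_satisfies.
Qed.

(** A variety containing both generators is defined by identities valid in both, and each of these
    satisfies the two combinatorial conditions; the one from L_2^1 also serves to derive the one
    from Q^1. *)
Lemma in_vjoin M :
    (forall u v, same_initial u v -> same_blocks u v -> satisfies M (u, v)) ->
  vjoin varL21 varQ1 M.
Proof.
move=> HM V [Sigma defV] subV; apply/defV => -[u v] Suv.
have L2 : satisfies (adjoin1 sgL2) (u, v).
  have /defV : V (adjoin1 sgL2) by apply: subV; left=> W _; apply.
  exact.
have Q : satisfies (adjoin1 sgQ) (u, v).
  have /defV : V (adjoin1 sgQ) by apply: subV; right=> W _; apply.
  exact.
have Luv : same_initial u v by apply/L21_satisfies.
exact: HM (same_blocks_of_satisfies Q1_regular Q1_not_cancel Q Luv).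
Qed.

Lemma vjoin_sub_varE1 : subclass (vjoin varL21 varQ1) varE1.
Proof.
move=> M JM V [Sigma defV] subV; apply/defV => -[u v] Suv.
have E : satisfies (adjoin1 sgE) (u, v).
  have /defV : V (adjoin1 sgE) by apply: subV.
  exact.
have Luv : same_initial u v :=
  same_initial_of_satisfies E1_regular E1_not_commute E.
exact: vjoin_satisfies (same_blocks_of_satisfies E1_regular E1_not_cancel E Luv).
Qed.

Theorem proposition5p1 :
  forall W : mclass,
    subvarieties varE1 W <->
      subvarieties (vjoin varL21 varQ1) W \/
      interval_varieties (vjoin varL21 varQ1) varE1 W.
Proof.
move=> W; split=> [[varW subW]|[[varW subW]|[]//]]; last first.
  by split=> // M /subW; apply: vjoin_sub_varE1.
have [joinW|njoinW] := pselect (subclass (vjoin varL21 varQ1) W); first by right.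
left; split=> // M WM; have regM := varE1_regular (subW M WM).
case: (varW) => Sigma defW.
(* As [W] does not contain the join, some defining identity of [W] violates one of the two
   conditions: otherwise the join would satisfy them all. *)
have [[u v] Suv nuv] : exists2 e, Sigma e &
    ~ (same_initial e.1 e.2 /\ same_blocks e.1 e.2).
  apply: contrapT => H; apply: njoinW => N JN; apply/defW => -[u v] Suv.
  have [Luv Quv] : same_initial u v /\ same_blocks u v.
    by apply: contrapT => nuv; apply: H; exists (u, v).
  exact: vjoin_satisfies.
have Muv : satisfies M (u, v) by move/defW: WM; apply.
apply: in_vjoin => u' v' Lu'v' Qu'v'; apply: (satisfies_same_blocks regM Qu'v').
have [Mcom|Mcom] := pselect (idempotents_commute M); first by left.
have Luv := same_initial_of_satisfies regM Mcom Muv.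
(* Were middle cancellation to fail too, [M] would force both conditions on the identity (u, v),
   which violates one of them. *)
right; split=> //; apply: contrapT => Mmid; apply: nuv; split=> //.
exact: same_blocks_of_satisfies Mmid Muv Luv.
Qed.
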